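(* Let $\oplus\subseteq[N]$ be a safe set, let $\hat F^*_\tau\ge F^*_\tau$ (with $\hat F^*_\tau\in\mathbb{R}\cup\{+\infty\}$), and let $s\in[N]$. For any $S\subseteq\oplus$, if $$0\ \ge\ \max_{x\in\mathcal{X},\,F(x)\le\hat F^*_\tau} c(x,\xi^{(s)})\quad\text{s.t.}\quad c(x,\xi^{(\tilde s)})\le 0\ \ \forall\tilde s\in S,$$ then $s$ may be added to the safe set, i.e. $\oplus\cup\{s\}$ is a safe set.
   Context: Setting. $\xi$ is a random vector in $\mathbb{R}^p$ with finite support $\{\xi^{(1)},\dots,\xi^{(N)}\}$ of cardinality $N$ (so the scenarios $\xi^{(s)}$ are pairwise distinct), $[N]=\{1,\dots,N\}$, and $\pi^{(s)}=\mathbb{P}[\xi=\xi^{(s)}]$, with $\sum_{s}\pi^{(s)}=1$. Let $\mathcal{X}\subseteq\mathbb{R}^d$, $F:\mathbb{R}^d\to\mathbb{R}$, $c:\mathbb{R}^d\times\mathbb{R}^p\to\mathbb{R}$, $\tau\in(0,1)$, and let $M^{(s)}\in\mathbb{R}$ satisfy $M^{(s)}\ge\max_{x\in\mathcal{X}}c(x,\xi^{(s)})$ for each $s\in[N]$. For $S\subseteq[N]$ define $\nu(S)$ as the optimal value of $\min_{x\in\mathcal{X}}F(x)$ subject to $c(x,\xi^{(s)})\le 0$ for all $s\in S$. Infeasible minimization problems have value $+\infty$, unbounded ones $-\infty$. Standing assumptions. (A) For every $s\in[N]$, $\pi^{(s)}>0$ and $\nu(\{s\})>-\infty$. (B) For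 every $x\in\mathcal{X}$, the function $c(x,\cdot)$ is quasi-convex on $\mathbb{R}^p$. Moreover, minima are attained: for every nonempty $S\subseteq[N]$ for which the problem defining $\nu(S)$ is feasible, that problem has a minimizer. Problem (MI-CCP), with optimal value $F^*_\tau$: minimize $F(x)$ over $x\in\mathcal{X}$, $z\in\{0,1\}^N$ subject to $\sum_{s=1}^N\pi^{(s)}z_s\ge 1-\tau$ and $c(x,\xi^{(s)})\le M^{(s)}(1-z_s)$ for all $s\in[N]$. Safe set: $\oplus\subseteq[N]$ is a safe set if including the equalities $z_s=1$ for every $s\in\oplus$ in (MI-CCP) does not increase its optimal value $F^*_\tau$. *)

(* Defs.v *)
(* MathComp-Analysis, over an abstract R : realType. *)
From mathcomp Require Export all_boot all_order all_algebra.
From mathcomp Require Export all_classical all_reals all_analysis.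
Set Implicit Arguments.
Unset Strict Implicit.
Unset Printing Implicit Defensive.
Import Order.TTheory GRing.Theory Num.Theory.

Local Open Scope classical_set_scope.
Local Open Scope ring_scope.

(* An infeasible problem has value +oo for minimization (ereal_inf set0) and
   -oo for maximization (ereal_sup set0). *)
Definition min_value (R : realType) (T : Type) (D : set T) (f : T -> R) :
    \bar R :=
  ereal_inf [set (f x)%:E | x in D].

Definition max_value (R : realType) (T : Type) (D : set T) (f : T -> R) :
    \bar R :=
  ereal_sup [set (f x)%:E | x in D].

Definition has_minimizer (R : realType) (T : Type) (D : set T) (f : T -> R) :
    Prop :=
  exists2 x, D x & forall y, D y -> f x <= f y.

Definition quasi_convex (R : realType) (p : nat) (f : 'rV[R]_p -> R) : Prop :=
  forall (u v : 'rV[R]_p) (t : R), 0 <= t <= 1 ->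
    f (t *: u + (1 - t) *: v) <= Num.max (f u) (f v).

(* A random vector is given by its coordinate random variables. *)
Definition random_vector (disp : measure_display) (Omega : measurableType disp)
    (R : realType) (P : probability Omega R) (p : nat)
    (Y : 'I_p -> {RV P >-> R}) (w : Omega) : 'rV[R]_p :=
  \row_j Y j w.

Definition scenario_prob (disp : measure_display)
    (Omega : measurableType disp) (R : realType) (P : probability Omega R)
    (p : nat) (Y : 'I_p -> {RV P >-> R}) (N : nat) (xi : 'I_N -> 'rV[R]_p)
    (s : 'I_N) : R :=
  fine (P [set w | random_vector Y w = xi s]).

Definition scenario_feasible (R : realType) (d p N : nat)
    (X : set 'rV[R]_d) (c : 'rV[R]_d -> 'rV[R]_p -> R)
    (xi : 'I_N -> 'rV[R]_p) (S : {set 'I_N}) : set 'rV[R]_d :=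
  [set x | X x /\ forall s, s \in S -> c x (xi s) <= 0].

Definition nu (R : realType) (d p N : nat)
    (X : set 'rV[R]_d) (F : 'rV[R]_d -> R) (c : 'rV[R]_d -> 'rV[R]_p -> R)
    (xi : 'I_N -> 'rV[R]_p) (S : {set 'I_N}) : \bar R :=
  min_value (scenario_feasible X c xi S) F.

Definition miccp_feasible (R : realType) (d p N : nat)
    (X : set 'rV[R]_d) (c : 'rV[R]_d -> 'rV[R]_p -> R)
    (xi : 'I_N -> 'rV[R]_p) (prob : 'I_N -> R) (M : 'I_N -> R) (tau : R) :
    set ('rV[R]_d * {ffun 'I_N -> bool}) :=
  [set xz : 'rV[R]_d * {ffun 'I_N -> bool} |
     [/\ X xz.1,
         1 - tau <= \sum_(s < N) prob s * (xz.2 s)%:R &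
         forall s, c xz.1 (xi s) <= M s * (1 - (xz.2 s)%:R)]].

Definition miccp_value (R : realType) (d p N : nat)
    (X : set 'rV[R]_d) (F : 'rV[R]_d -> R) (c : 'rV[R]_d -> 'rV[R]_p -> R)
    (xi : 'I_N -> 'rV[R]_p) (prob : 'I_N -> R) (M : 'I_N -> R) (tau : R) :
    \bar R :=
  min_value (miccp_feasible X c xi prob M tau) (fun xz => F xz.1).

Definition safe_set (R : realType) (d p N : nat)
    (X : set 'rV[R]_d) (F : 'rV[R]_d -> R) (c : 'rV[R]_d -> 'rV[R]_p -> R)
    (xi : 'I_N -> 'rV[R]_p) (prob : 'I_N -> R) (M : 'I_N -> R) (tau : R)
    (A : {set 'I_N}) : Prop :=
  (min_value
     (miccp_feasible X c xi prob M tau `&`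
      [set xz : 'rV[R]_d * {ffun 'I_N -> bool} |
         forall s, s \in A -> xz.2 s = true])
     (fun xz => F xz.1)
   <= miccp_value X F c xi prob M tau)%E.

Definition screening_feasible (R : realType) (d p N : nat)
    (X : set 'rV[R]_d) (F : 'rV[R]_d -> R) (c : 'rV[R]_d -> 'rV[R]_p -> R)
    (xi : 'I_N -> 'rV[R]_p) (Upper : \bar R) (S : {set 'I_N}) :
    set 'rV[R]_d :=
  scenario_feasible X c xi S `&` [set x | ((F x)%:E <= Upper)%E].

(* Main.v *)
Require Import Defs.
Set Implicit Arguments.
Unset Strict Implicit.
Unset Printing Implicit Defensive.
Import Order.TTheory GRing.Theory Num.Theory.
Local Open Scope classical_set_scope.
Local Open Scope ring_scope.

(** Fix the 0-1 vector z in (MI-CCP). The big-M bounds hold on all of X, so what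
    remains is the scenario problem for the support of z
    ([miccp_feasible_iff]); that support is nonempty because its probability
    is at least 1 - tau > 0, so the fixed-z problem attains its minimum whenever
    it is feasible. There are only finitely many z, hence (MI-CCP) with the
    scenarios of the safe set A enforced also attains its minimum as soon as it
    is feasible ([safe_miccp_has_minimizer]).

    Let (x, z) be such a minimizer. As A is safe, F(x) is at most the optimal
    value of (MI-CCP), hence at most the upper bound, and x satisfies the
    constraints of S because S is a subset of A. So x competes in the screening
    problem, whose value is at most 0, and therefore satisfies scenario s.
    Switching z_s to 1 keeps (x, z) feasible with the same objective, now with
    the scenarios of A and s all enforced. When no such minimizer exists,
    safety of A forces (MI-CCP) to be infeasible, and every set is safe.

    Attainment is essential: if the upper bound equals the optimal value, only
    an exact optimum is a candidate in the screening problem. *)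

Lemma le_max_value (R : realType) (T : Type) (D : set T) (f : T -> R)
    (a : \bar R) x : (max_value D f <= a)%E -> D x -> ((f x)%:E <= a)%E.
Proof. by move=> Da Dx; apply: le_trans Da; apply: ereal_sup_ubound; exists x. Qed.

Lemma min_value_le (R : realType) (T : Type) (D : set T) (f : T -> R) x :
  D x -> (min_value D f <= (f x)%:E)%E.
Proof. by move=> Dx; apply: ereal_inf_lbound; exists x. Qed.

Lemma min_value_minimizer (R : realType) (T : Type) (D : set T) (f : T -> R)
    x : D x -> (forall y, D y -> f x <= f y) -> min_value D f = (f x)%:E.
Proof.
move=> Dx x_min; apply/eqP; rewrite eq_le min_value_le //=.
by apply: le_ereal_inf_tmp => _ [y Dy <-]; rewrite lee_fin; exact: x_min.
Qed.

(** A finite minimum of attained minima is attained; this lifts attainment from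
    the continuous variable to a mixed problem with a finite-valued variable. *)
Lemma has_minimizer_finite_fibers (R : realType) (T : Type) (I : finType)
    (D : set (T * I)) (f : T -> R) :
  (forall i, [set x | D (x, i)] !=set0 ->
     has_minimizer [set x | D (x, i)] f) ->
  D !=set0 -> has_minimizer D (fun xi => f xi.1).
Proof.
move=> fiber_min [[x0 i0] D0].
have /choice[m mP] : forall i, exists x, [set x | D (x, i)] !=set0 ->
    D (x, i) /\ forall y, D (y, i) -> f x <= f y.
  move=> i; have [ne|empty] := pselect ([set x | D (x, i)] !=set0).
    by have [x Dx x_min] := fiber_min i ne; exists x.
  by exists x0 => /empty.
pose P i := `[< [set x | D (x, i)] !=set0 >].
have ne0 : P i0 by apply/asboolP; exists x0.
case: (arg_minP (fun i => f (m i)) ne0) => i /asboolP/mP[Di _] i_min.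
exists (m i, i) => // -[y j] Dyj /=.
have nej : [set x | D (x, j)] !=set0 by exists y.
have [_ j_min] := mP j nej.
by apply: le_trans (j_min y Dyj); apply: i_min; apply/asboolP.
Qed.

(** The big-M constraint of scenario s is c(x, xi_s) <= 0 when z_s = 1, and is
    implied by x in X, through the bound on M_s, when z_s = 0. *)
Lemma miccp_feasible_iff (R : realType) (d p N : nat) (X : set 'rV[R]_d)
    (c : 'rV[R]_d -> 'rV[R]_p -> R) (xi : 'I_N -> 'rV[R]_p)
    (prob M : 'I_N -> R) (tau : R)
    (M_ge : forall s, (max_value X (fun x => c x (xi s)) <= (M s)%:E)%E)
    (x : 'rV[R]_d) (z : {ffun 'I_N -> bool}) :
  miccp_feasible X c xi prob M tau (x, z) <->
  1 - tau <= \sum_(s < N) prob s * (z s)%:R /\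
  scenario_feasible X c xi [set s | z s]%SET x.
Proof.
split=> [[/= Xx weight bigM]|[weight [Xx sat]]].
  split=> //; split=> // s; rewrite inE => zs.
  by have := bigM s; rewrite zs subrr mulr0.
split=> //= s; case zs: (z s).
  by rewrite subrr mulr0; apply: sat; rewrite inE.
by rewrite subr0 mulr1 -lee_fin; apply: (le_max_value (M_ge s)).
Qed.

(** Attainment is assumed only for nonempty scenario sets; tau < 1 rules out the
    empty one, since the support of a feasible z has positive weight. *)
Lemma safe_miccp_has_minimizer (R : realType) (d p N : nat)
    (X : set 'rV[R]_d) (F : 'rV[R]_d -> R) (c : 'rV[R]_d -> 'rV[R]_p -> R)
    (xi : 'I_N -> 'rV[R]_p) (prob M : 'I_N -> R) (tau : R)
    (tau_lt1 : tau < 1)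
    (M_ge : forall s, (max_value X (fun x => c x (xi s)) <= (M s)%:E)%E)
    (min_attained : forall S : {set 'I_N}, S != finset.set0 ->
       scenario_feasible X c xi S !=set0 ->
       has_minimizer (scenario_feasible X c xi S) F)
    (A : {set 'I_N}) :
  let D := miccp_feasible X c xi prob M tau `&`
    [set xz : 'rV[R]_d * {ffun 'I_N -> bool} |
       forall s, s \in A -> xz.2 s = true] in
  D !=set0 -> has_minimizer D (fun xz => F xz.1).
Proof.
move=> D; apply: has_minimizer_finite_fibers => z [x [feas zA]].
have [weight x_sat] := (miccp_feasible_iff prob tau M_ge x z).1 feas.
have supp_neq0 : [set s | z s]%SET != finset.set0.
  apply: contraTneq weight => supp0; rewrite -ltNge big1 ?subr_gt0// => s _.
  by have := finset.in_set0 s; rewrite -supp0 inE => ->; rewrite mulr0.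
have [|y y_sat y_min] := min_attained _ supp_neq0; first by exists x.
exists y => [|y' [feas' _]].
  by split=> //; apply/(miccp_feasible_iff prob tau M_ge).
by apply: y_min; case/(miccp_feasible_iff prob tau M_ge): feas'.
Qed.

(** Switching on a scenario that x already satisfies only adds weight. *)
Lemma miccp_feasible_switch_on (R : realType) (d p N : nat)
    (X : set 'rV[R]_d) (c : 'rV[R]_d -> 'rV[R]_p -> R)
    (xi : 'I_N -> 'rV[R]_p) (prob M : 'I_N -> R) (tau : R)
    (x : 'rV[R]_d) (z : {ffun 'I_N -> bool}) (s : 'I_N) :
  0 <= prob s -> c x (xi s) <= 0 ->
  miccp_feasible X c xi prob M tau (x, z) ->
  miccp_feasible X c xi prob M tau (x, [ffun t => z t || (t == s)]).
Proof.
move=> prob_ge0 sat [/= Xx weight bigM]; split=> //=.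
  apply: le_trans weight _; apply: ler_sum => t _; rewrite ffunE.
  case: eqVneq => [->|_]; last by rewrite orbF.
  by rewrite orbT ler_wpM2l// ler_nat leq_b1.
move=> t; rewrite ffunE; case: eqVneq => [->|_]; last by rewrite orbF; exact: bigM.
by rewrite orbT subrr mulr0.
Qed.

Theorem proposition1 (R : realType) (d p N : nat)
    (disp : measure_display) (Omega : measurableType disp)
    (P : probability Omega R) (Y : 'I_p -> {RV P >-> R})
    (xi : 'I_N -> 'rV[R]_p)
    (X : set 'rV[R]_d) (F : 'rV[R]_d -> R) (c : 'rV[R]_d -> 'rV[R]_p -> R)
    (tau : R) (M : 'I_N -> R)
    (xi_inj : injective xi)
    (prob_sum1 : \sum_(s < N) scenario_prob Y xi s = 1)
    (tau01 : 0 < tau < 1)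
    (M_ge : forall s, (max_value X (fun x => c x (xi s)) <= (M s)%:E)%E)
    (prob_gt0 : forall s, 0 < scenario_prob Y xi s)
    (nu1_gtNy : forall s, (-oo < nu X F c xi [set s]%SET)%E)
    (c_qconvex : forall x, X x -> quasi_convex (c x))
    (min_attained : forall S : {set 'I_N}, S != finset.set0 ->
       scenario_feasible X c xi S !=set0 ->
       has_minimizer (scenario_feasible X c xi S) F)
    (A : {set 'I_N})
    (A_safe : safe_set X F c xi (scenario_prob Y xi) M tau A)
    (Upper : \bar R)
    (Upper_gtNy : (-oo < Upper)%E)
    (Upper_ge : (miccp_value X F c xi (scenario_prob Y xi) M tau <= Upper)%E)
    (s : 'I_N) (S : {set 'I_N}) (S_sub_A : S \subset A)
    (screen : (max_value (screening_feasible X F c xi Upper S)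
                 (fun x => c x (xi s)) <= 0)%E) :
  safe_set X F c xi (scenario_prob Y xi) M tau (A :|: [set s])%SET.
Proof.
set D := miccp_feasible X c xi (scenario_prob Y xi) M tau `&`
  [set xz : 'rV[R]_d * {ffun 'I_N -> bool} |
     forall s, s \in A -> xz.2 s = true].
have [D_neq0|D_eq0] := pselect (D !=set0); last first.
  have : (+oo <= miccp_value X F c xi (scenario_prob Y xi) M tau)%E.
    apply: le_trans A_safe; apply: le_ereal_inf_tmp => _ [xz Dxz <-].
    by case: D_eq0; exists xz.
  by rewrite leye_eq /safe_set => /eqP ->; exact: leey.
have tau_lt1 : tau < 1 by case/andP: tau01.
have [[x z] Dxz xz_min] :=
  safe_miccp_has_minimizer tau_lt1 M_ge min_attained D_neq0.
have Fx_le : ((F x)%:E <= miccp_value X F c xi (scenario_prob Y xi) M tau)%E.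
  by rewrite -(min_value_minimizer Dxz xz_min).
have [feas zA] := Dxz; have [Xx x_sat] :=
  ((miccp_feasible_iff _ tau M_ge x z).1 feas).2.
have x_sat_s : c x (xi s) <= 0.
  rewrite -lee_fin; apply: (le_max_value screen).
  split; last exact: le_trans Upper_ge.
  by split=> // t tS; apply: x_sat; rewrite inE zA// (fintype.subsetP S_sub_A).
apply: le_trans Fx_le.
apply: (@min_value_le _ _ _ _ (x, [ffun t => z t || (t == s)])).
split; first exact: miccp_feasible_switch_on (ltW (prob_gt0 s)) x_sat_s feas.
by move=> t /=; rewrite ffunE !inE => /orP[/zA ->|->] //; rewrite orbT.
Qed.
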